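(* Let $X$ be a nonempty finite set and let $\theta_X$ be a formigram over $X$ with bounded support and with critical points in $\mathbb{Z}$. A nonempty subset $G\subset X$ is a maximal group of $\theta_X$ on a (nonempty) interval $I\subset\mathbb{R}$ if and only if $I\in\mathcal{I}$ and $G$ is a block of the subpartition $\Pi\,\mathrm{dgm}^{\bigwedge}(\theta_X)(I)$.
   Context: Subpartitions. A subpartition of $X$ is a partition $P$ of a (possibly empty) subset of $X$ (the partition of $\emptyset$ is $\emptyset$). Its elements are called blocks. $\mathrm{SubPart}(X)$ is the set of all subpartitions of $X$, ordered by $P\le Q$ iff every block of $P$ is contained in some block of $Q$. It is a lattice: $P\vee Q$ is the finest common coarsening and $P\wedge Q$ the coarsest common refinement (blocks: nonempty intersections of a block of $P$ and a block of $Q$). Formigrams. A formigram over $X$ is a map $\theta_X:\mathbb{R}\to\mathrm{SubPart}(X)$ such that (a) there is a locally finite set $C\subset\mathbb{R}$ of ''critical points'' such that $\theta_X$ is constant on each connected component of $\mathbb{R}\setminus C$ and for every $c\in C$ there is $r_c>0$ with $\theta_X(c-\varepsilon)\le\theta_X(c)\ge\theta_X(c+\varepsilon)$ for all $\varepsilon\in[0,r_c)$; (b) for each $x\in X$ there is a (nonempty) closed interval $I_x\subset\mathbb{R}$ (lifespan) with $x\in\bigcup\theta_X(t)$ iff $t\in I_x$. The support of $\theta_X$ is $\bigcup_{x}I_x$. ''Critical points in $\mathbb{Z}$'' means that $C\subset\mathbb{Z}$ can be chosen. Groups. A set $G\subset X$ is a group over an interval $I_G\subset\mathbb{R}$ if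 for all $t\in I_G$ there is $B_t\in\theta_X(t)$ with $G\subset B_t$. A group $H$ over $I_H$ covers a group $G$ over $I_G$ if $G\subset H$ and $I_G\subset I_H$. A group $G$ over $I_G$ is a maximal group (on $I_G$) if no group $H$ over an interval $I_H$ with $(H,I_H)\neq(G,I_G)$ covers it. $\mathcal{I}$ denotes the set of all nonempty bounded intervals of $\mathbb{R}$ (open, closed or half-open) with integer endpoints. For $I\in\mathcal{I}$, $I^-$ is the smallest element of $\mathcal{I}$ strictly enlarging $I$ only on the left (a left end ''$(b$'' becomes ''$[b$'', a left end ''$[b$'' becomes ''$(b-1$''); $I^+$ is the smallest element strictly enlarging $I$ only on the right (''$d)$'' becomes ''$d]$'', ''$d]$'' becomes ''$d+1)$''); $I^{\pm}=I^-\cup I^+$. For $I\in\mathcal{I}$ let $\bigwedge_I\theta_X=\bigwedge\{\theta_X(t):t\in I\}$. Let $\mathbb{Z}\,\mathrm{pow}(X)$ be the free abelian group on the power set of $X$; a subpartition $\{B_i\}_i$ is identified with $\sum_i1\cdot B_i$. Define $\mathrm{dgm}^{\bigwedge}(\theta_X):\mathcal{I}\to\mathbb{Z}\,\mathrm{pow}(X)$ by $$\mathrm{dgm}^{\bigwedge}(\theta_X)(I)=\textstyle\bigwedge_I\theta_X-\bigwedge_{I^+}\theta_X-\bigwedge_{I^-}\theta_X+\bigwedge_{I^\pm}\theta_X .$$ The map $\Pi:\mathbb{Z}\,\mathrm{pow}(X)\to\mathrm{SubPart}(X)$ sends $0$ to $\emptyset$ and sends $\sum_{i=1}^{\ell}m_iB_i$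 (distinct $B_i$, all $m_i\ne0$) to $\bigvee_{i=1}^{\ell}\{B_i\}$. The maximal group diagram of $\theta_X$ is $\Pi\,\mathrm{dgm}^{\bigwedge}(\theta_X):=\Pi\circ\mathrm{dgm}^{\bigwedge}(\theta_X)$. *)

(* Defs.v *)
From HB Require Import structures.
From mathcomp Require Import all_boot all_order all_algebra.
From mathcomp Require Import all_classical all_reals all_analysis.

Set Implicit Arguments.
Unset Strict Implicit.
Unset Printing Implicit Defensive.

Import Order.TTheory GRing.Theory Num.Theory numFieldNormedType.Exports.

Local Open Scope classical_set_scope.
Local Open Scope ring_scope.

Record subpart (X : finType) := Subpart {
  blocks :> {set {set X}};
  _ : [exists D : {set X}, finset.partition blocks D]
}.

HB.instance Definition _ (X : finType) := [isSub for @blocks X].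
HB.instance Definition _ (X : finType) := [Finite of subpart X by <:].

Fact subpart_display : Order.disp_t.
Proof. exact: Order.default_display. Qed.

Section SubpartLattice.
Context {X : finType}.
Implicit Types (P Q S : subpart X) (A B C D : {set X}).

Lemma subpart_triv P B C x :
  B \in P -> C \in P -> x \in B -> x \in C -> B = C.
Proof.
case: P => P /= /existsP[D /and3P[_ /finset.trivIsetP tP _]] BP CP xB xC.
apply/eqP; apply: contraT => /(tP _ _ BP CP) /pred0P/(_ x) /=.
by rewrite xB xC.
Qed.

Lemma subpart_neq0 P B : B \in P -> B != finset.set0.
Proof.
case: P => P /= /existsP[D /and3P[_ _ n0]] BP.
by apply: contraNneq n0 => <-.
Qed.

Definition subpart_le P Q : bool :=
  [forall B in P, [exists C in Q, B \subset C]].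

Lemma subpart_leP P Q :
  reflect (forall B, B \in P -> exists2 C, C \in Q & B \subset C)
          (subpart_le P Q).
Proof.
apply: (iffP forall_inP) => h B /h => [/exists_inP//|?]; exact/exists_inP.
Qed.

Lemma subpart_le_refl : reflexive subpart_le.
Proof. by move=> P; apply/subpart_leP => B BP; exists B. Qed.

Lemma subpart_le_trans : transitive subpart_le.
Proof.
move=> Q P S /subpart_leP PQ /subpart_leP QS; apply/subpart_leP => B /PQ[C].
by move=> /QS[D DS CD] BC; exists D => //; apply: fintype.subset_trans CD.
Qed.

Lemma subpart_le_sub P Q :
  subpart_le P Q -> subpart_le Q P -> {subset P <= Q}.
Proof.
move=> /subpart_leP PQ /subpart_leP QP B BP.
have [C CQ BC] := PQ _ BP; have [D DP CD] := QP _ CQ.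
have /finset.set0Pn[x xB] := subpart_neq0 BP.
have xD : x \in D by rewrite (fintype.subsetP CD)// (fintype.subsetP BC).
have BD := subpart_triv BP DP xB xD.
by have -> : B = C by apply/eqP; rewrite finset.eqEsubset BC BD.
Qed.

Lemma subpart_le_anti : antisymmetric subpart_le.
Proof.
move=> P Q /andP[PQ QP]; apply/val_inj/finset.setP => B.
by apply/idP/idP; [apply: (subpart_le_sub PQ QP)|apply: (subpart_le_sub QP PQ)].
Qed.

Definition meet_blocks P Q : {set {set X}} :=
  [set B :&: C | B in P, C in Q & B :&: C != finset.set0]%SET.

Lemma meet_blocksP P Q D :
  reflect (exists B C, [/\ B \in P, C \in Q, D != finset.set0 & D = B :&: C])
          (D \in meet_blocks P Q).
Proof.
apply: (iffP imset2P) => [[B C BP]|[B [C [BP CQ D0 DE]]]].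
  by rewrite inE => /andP[CQ n0] ->; exists B, C.
by exists B C => //; rewrite inE CQ -DE.
Qed.

Lemma meet_blocks_subproof P Q :
  [exists D : {set X}, finset.partition (meet_blocks P Q) D].
Proof.
apply/existsP; exists (finset.cover (meet_blocks P Q)); apply/and3P; split => //.
  apply/finset.trivIsetP => D E /meet_blocksP[B [C [BP CQ _ ->]]].
  move=> /meet_blocksP[B' [C' [BP' CQ' _ ->]]]; apply: contraR.
  move=> /pred0Pn[x /= /andP[/finset.setIP[xB xC] /finset.setIP[xB' xC']]].
  by rewrite (subpart_triv BP BP' xB xB') (subpart_triv CQ CQ' xC xC').
by apply/negP => /meet_blocksP[B [C [_ _ /eqP]]].
Qed.

Definition subpart_meet P Q := Subpart (meet_blocks_subproof P Q).

Definition same_block P Q : rel X :=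
  fun x y => [exists B in P :|: Q, (x \in B) && (y \in B)].

(* Two points lie in the same block of the join when they are linked by a
   chain of points, consecutive ones sharing a block of P or of Q. *)
Definition join_blocks P Q : {set {set X}} :=
  finset.equivalence_partition (connect (same_block P Q))
    (finset.cover P :|: finset.cover Q).

Lemma same_block_sym P Q : symmetric (same_block P Q).
Proof. by move=> x y; apply: eq_existsb => B; rewrite [(y \in B) && _]andbC. Qed.

Lemma join_blocks_equiv P Q (D : {set X}) :
  {in D & &, equivalence_rel (connect (same_block P Q))}.
Proof.
move=> x y z _ _ _; split; first exact: connect0.
move=> xy; apply: same_connect => //.
exact/sym_connect_sym/same_block_sym.
Qed.

Lemma join_blocks_subproof P Q :
  [exists D : {set X}, finset.partition (join_blocks P Q) D].
Proof.
apply/existsP; exists (finset.cover P :|: finset.cover Q).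
exact/finset.equivalence_partitionP/join_blocks_equiv.
Qed.

Definition subpart_join P Q := Subpart (join_blocks_subproof P Q).

Lemma bot_subproof : [exists D : {set X}, finset.partition finset.set0 D].
Proof.
apply/existsP; exists finset.set0; apply/and3P; split.
- by rewrite /finset.cover big_set0.
- by apply/finset.trivIsetP => A B; rewrite inE.
- by rewrite inE.
Qed.

Definition subpart_bot := Subpart bot_subproof.

Lemma single_subproof B :
  [exists D : {set X}, finset.partition ([set B] :\ finset.set0)%SET D].
Proof.
apply/existsP; exists (finset.cover ([set B] :\ finset.set0)%SET).
apply/and3P; split => //; last by rewrite !inE eqxx.
by apply/finset.trivIsetP => A C; rewrite !inE => /andP[_ /eqP ->] /andP[_ /eqP ->];
  rewrite eqxx.
Qed.

(* {B}, or the empty subpartition when B is empty. *)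
Definition single B : subpart X := Subpart (single_subproof B).

Lemma subpart_lexI P Q S :
  subpart_le P (subpart_meet Q S) = subpart_le P Q && subpart_le P S.
Proof.
apply/subpart_leP/andP => [h|[/subpart_leP PQ /subpart_leP PS] B BP].
  split; apply/subpart_leP => B /h[_ /meet_blocksP[C [D [CQ DS _ ->]]]];
  rewrite finset.subsetI => /andP[? ?]; by [exists C|exists D].
have [C CQ BC] := PQ _ BP; have [D DS BD] := PS _ BP.
have BCD : B \subset C :&: D by rewrite finset.subsetI BC.
exists (C :&: D) => //; apply/meet_blocksP; exists C, D; split => //.
by apply: contraNneq (subpart_neq0 BP) => E; rewrite -finset.subset0 -E.
Qed.

Lemma subpart_leUx P Q S :
  subpart_le (subpart_join P Q) S = subpart_le P S && subpart_le Q S.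
Proof.
apply/idP/andP => [h|[/subpart_leP PS /subpart_leP QS]].
  have ub B : B \in P :|: Q -> exists2 C, C \in S & B \subset C.
    move=> BPQ; have /finset.set0Pn[x xB] : B != finset.set0.
      by case/finset.setUP: BPQ; exact: subpart_neq0.
    have inD y : y \in B -> y \in finset.cover P :|: finset.cover Q.
      move=> yB; case/finset.setUP: BPQ => BPQ; apply/finset.setUP; [left|right];
      by apply/finset.bigcupP; exists B.
    pose C := [set y in finset.cover P :|: finset.cover Q |
               connect (same_block P Q) x y]%SET.
    have CJ : C \in subpart_join P Q by apply/imsetP; exists x => //; apply: inD.
    have [D DS CD] := subpart_leP _ _ h _ CJ; exists D => //.
    apply: fintype.subset_trans CD; apply/fintype.subsetP => y yB.
    rewrite inE inD//=; apply: connect1.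
    by apply/exists_inP; exists B => //; rewrite xB.
  by split; apply/subpart_leP => B BP; apply: ub; rewrite inE BP ?orbT.
have ub B : B \in P :|: Q -> exists2 C, C \in S & B \subset C.
  by move=> /finset.setUP[/PS|/QS].
apply/subpart_leP => _ /imsetP[x xD ->].
have [B BPQ xB] : exists2 B, B \in P :|: Q & x \in B.
  by case/finset.setUP: xD => /finset.bigcupP[B BP xB]; exists B => //;
    rewrite inE BP ?orbT.
have [C CS BC] := ub _ BPQ; exists C => //.
have clC : fingraph.closed (same_block P Q) (mem C).
  apply: intro_closed; first exact/sym_connect_sym/same_block_sym.
  move=> y z /exists_inP[B' /ub[C' CS' BC'] /andP[yB zB]] yC.
  have yC' := fintype.subsetP BC' _ yB.
  by rewrite (subpart_triv CS CS' yC yC') (fintype.subsetP BC').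
apply/fintype.subsetP => y; rewrite inE => /andP[_ /(closed_connect clC) <-].
exact: fintype.subsetP BC _ xB.
Qed.

Lemma subpart_le0x P : subpart_le subpart_bot P.
Proof. by apply/subpart_leP => B; rewrite inE. Qed.

Lemma subpart_lex1 P : subpart_le P (single [set: X]%SET).
Proof.
apply/subpart_leP => B BP; exists [set: X]%SET; last exact: finset.subsetT.
rewrite !inE eqxx andbT; apply: contraNneq (subpart_neq0 BP) => E.
by rewrite -finset.subset0 -E finset.subsetT.
Qed.

End SubpartLattice.

HB.instance Definition _ (X : finType) :=
  Order.Le_isPOrder.Build subpart_display (subpart X)
    (@subpart_le_refl X) (@subpart_le_anti X) (@subpart_le_trans X).
HB.instance Definition _ (X : finType) :=
  Order.POrder_MeetJoin_isLattice.Build subpart_display (subpart X)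
    (@subpart_lexI X) (@subpart_leUx X).
HB.instance Definition _ (X : finType) :=
  Order.hasBottom.Build subpart_display (subpart X) (@subpart_le0x X).
HB.instance Definition _ (X : finType) :=
  Order.hasTop.Build subpart_display (subpart X) (@subpart_lex1 X).

Section Formigram.
Context {R : realType} {X : finType}.
Implicit Types (theta : R -> subpart X) (C I : set R) (G H : {set X}).

Definition locally_finite C : Prop :=
  forall x : R, exists2 U, nbhs x U & finite_set (C `&` U).

Definition critical_set theta C : Prop :=
  (forall s t, connected_component (~` C) s t -> theta s = theta t) /\
  (forall c, C c -> exists2 r : R, 0 < r &
     forall e, 0 <= e < r ->
       (theta (c - e) <= theta c)%O /\ (theta (c + e) <= theta c)%O).

Definition lifespan theta (x : X) : set R := [set t | x \in finset.cover (theta t)].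

Definition formigram theta : Prop :=
  (exists2 C, locally_finite C & critical_set theta C) /\
  (forall x, [/\ lifespan theta x !=set0, is_interval (lifespan theta x)
               & closed (lifespan theta x)]).

Definition formigram_support theta : set R := \bigcup_x lifespan theta x.

Definition integer_critical_points theta : Prop :=
  exists C, [/\ C `<=` range (fun n : int => n%:~R), locally_finite C
              & critical_set theta C].

Definition group_over theta G I : Prop :=
  is_interval I /\
  forall t, I t -> exists2 B, B \in theta t & G \subset B.

Definition covers H (J : set R) G I : Prop := G \subset H /\ I `<=` J.

Definition maximal_group theta G I : Prop :=
  group_over theta G I /\
  ~ exists H J, [/\ group_over theta H J, (H, J) <> (G, I) & covers H J G I].

End Formigram.

(* A nonempty bounded interval of a realType with integer endpoints, given by
   its two bounds (b, n), read as BSide b n: "true" is a closed left bound but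
   an open right bound. Distinct values denote distinct intervals; the
   condition is nonemptiness in the reals by zitv_nonempty, so that for
   instance ]0, 1[ is included. *)
Record zitv := Zitv {
  zlo : bool * int;
  zhi : bool * int;
  zitvP : (BSide zlo.1 zlo.2 < BSide zhi.1 zhi.2)%O
}.

Definition zset (R : realType) (I : zitv) : set R :=
  [set` Interval (BSide (zlo I).1 (zlo I).2%:~R)
                 (BSide (zhi I).1 (zhi I).2%:~R)].
Arguments zset : clear implicits.

Lemma zitv_nonempty (R : realType) (b c : bool) (m n : int) :
  ([set` Interval (BSide b (m%:~R : R)) (BSide c n%:~R)] !=set0) <->
  (BSide b m < BSide c n)%O.
Proof.
rewrite -set0P -[_ != _]/(neitv _) neitvE /=.
by case: b c => -[] /=; rewrite !bnd_simp ?ler_int ?ltr_int.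
Qed.

Definition bound_left (lo : bool * int) : bool * int :=
  if lo.1 then (false, lo.2 - 1) else (true, lo.2).
Definition bound_right (hi : bool * int) : bool * int :=
  if hi.1 then (false, hi.2) else (true, hi.2 + 1).

Lemma zext_left_subproof (I : zitv) :
  (BSide (bound_left (zlo I)).1 (bound_left (zlo I)).2 <
   BSide (zhi I).1 (zhi I).2)%O.
Proof.
case: I => -[b m] [c n] /=; apply: le_lt_trans; rewrite /bound_left /=.
by case: b => /=; rewrite !bnd_simp// ltrBlDr ltzD1.
Qed.

Lemma zext_right_subproof (I : zitv) :
  (BSide (zlo I).1 (zlo I).2 <
   BSide (bound_right (zhi I)).1 (bound_right (zhi I)).2)%O.
Proof.
case: I => -[b m] [c n] /= /lt_le_trans; apply; rewrite /bound_right /=.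
by case: c => /=; rewrite !bnd_simp// ltzD1.
Qed.

Definition zext_left (I : zitv) : zitv := Zitv (zext_left_subproof I).
Definition zext_right (I : zitv) : zitv := Zitv (zext_right_subproof I).

Section MaximalGroupDiagram.
Context {R : realType} {X : finType}.
Implicit Types (theta : R -> subpart X) (I : zitv) (P : subpart X).

Definition bigmeet theta (A : set R) : subpart X :=
  (\meet_(P : subpart X | P \in theta @` A) P)%O.

(* As X is finite, {ffun {set X} -> int} is the free abelian group on the
   power set of X. *)
Definition zpow_gen (B : {set X}) : {ffun {set X} -> int} :=
  [ffun A => (A == B)%:R].

Definition zpow_of P : {ffun {set X} -> int} := \sum_(B in P) zpow_gen B.

Definition dgm_meet theta I : {ffun {set X} -> int} :=
  zpow_of (bigmeet theta (zset R I))
  - zpow_of (bigmeet theta (zset R (zext_right I)))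
  - zpow_of (bigmeet theta (zset R (zext_left I)))
  + zpow_of (bigmeet theta (zset R (zext_left I) `|` zset R (zext_right I))).

Definition Pi_zpow (f : {ffun {set X} -> int}) : subpart X :=
  (\join_(B : {set X} | f B != 0) single B)%O.

Definition maximal_group_diagram theta I : subpart X :=
  Pi_zpow (dgm_meet theta I).

End MaximalGroupDiagram.

(* Main.v *)
(* Write P, Q, S for the meets of theta over J, J^+ and J^-, so that the meet
   over the union of J^- and J^+ is Q /\ S. A common block C of P and Q is
   untouched by meeting with Q, so the alternating sum P - Q - S + Q /\ S
   vanishes on all subsets of C, and likewise for common blocks of P and S. A
   block of P that lies neither in Q nor in S has coefficient 1 and absorbs in
   the join every smaller set with a nonzero coefficient below it. Hence the
   blocks of the diagram at J are the blocks of P that lie neither in Q nor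
   in S: the groups that are maximal on J and survive neither elementary
   extension of J.
   These are the maximal groups, because theta is constant on each ]n, n + 1[
   with values below theta n and theta (n + 1): a group over an interval
   meeting ]n, n + 1[ is a group over the whole of [n, n + 1]. So a group that
   extends beyond J extends to J^+ or J^-, and a maximal group lives over some
   [a, b] with integer a and b, boundedness coming from the support. *)
Require Import Defs.
From mathcomp Require Import all_boot all_order all_algebra.
From mathcomp Require Import all_classical all_reals all_analysis.
From mathcomp Require Import lra.
Import Order.TTheory GRing.Theory Num.Theory numFieldNormedType.Exports.
Local Open Scope classical_set_scope.
Local Open Scope ring_scope.

(** * Subpartitions and the alternating sum *)

Section Subpartitions.
Context {X : finType}.
Implicit Types (P Q S : subpart X) (A B C : {set X}).

Lemma le_subpartE P Q : (P <= Q)%O = subpart_le P Q.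
Proof. by []. Qed.

(** Turns containment in a block into an order relation, so that transitivity and the universal
    properties of meets and joins apply. *)
Lemma single_le P B : B != finset.set0 ->
  reflect (exists2 C, C \in P & B \subset C) (single B <= P)%O.
Proof.
move=> B0; rewrite le_subpartE; apply: (iffP (subpart_leP _ _)).
  by apply; rewrite !inE eqxx andbT.
by move=> ex A; rewrite !inE => /andP[_ /eqP ->].
Qed.

Lemma sub_block_eq {P B C} : B \in P -> C \in P -> B \subset C -> B = C.
Proof.
move=> BP CP BC; have /finset.set0Pn[x xB] := subpart_neq0 BP.
exact: subpart_triv BP CP xB (fintype.subsetP BC _ xB).
Qed.

(* A common block of [P] and [Q <= P] is untouched by the meet with [Q], which
   is why [P] and [Q], as well as [S] and the meet of [Q] and [S], agree in it. *)
Lemma common_block P Q S B C : (Q <= P)%O -> (S <= P)%O ->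
    C \in P -> C \in Q -> B \subset C ->
  (B \in P) = (B \in Q) /\ (B \in S) = (B \in (Q `&` S)%O).
Proof.
move=> /subpart_leP QP /subpart_leP SP CP CQ BC; split.
  by apply/idP/idP => BT; rewrite (sub_block_eq BT _ BC).
apply/idP/meet_blocksP => [BS|[D [E [DQ ES B0 BE]]]].
  exists C, B; split => //; first exact: subpart_neq0 BS.
  by rewrite (finset.setIidPr BC).
have /finset.set0Pn[x xB] := B0.
have /finset.setIP[xD xE] : x \in D :&: E by rewrite -BE.
have xC := fintype.subsetP BC _ xB.
have [F FP EF] := SP _ ES.
have FC := subpart_triv FP CP (fintype.subsetP EF _ xE) xC.
have DC := subpart_triv DQ CQ xD xC.
have EC : E \subset C by rewrite -FC.
by rewrite BE DC (finset.setIidPr EC).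
Qed.

Lemma zpow_ofE P B : zpow_of P B = (B \in P)%:R.
Proof.
rewrite /zpow_of sum_ffunE; under eq_bigr do rewrite ffunE.
have [BP|BP] := boolP (B \in P).
  rewrite (bigD1 B)//= eqxx big1 ?addr0// => C /andP[_].
  by rewrite eq_sym => /negPf ->.
rewrite big1// => C CP; case: eqP => // BC.
by rewrite BC CP in BP.
Qed.

Lemma dead_blocks_subproof P Q S :
  [exists D : {set X}, finset.partition (P :\: (Q :|: S)) D].
Proof.
apply/existsP; exists (finset.cover (P :\: (Q :|: S))); apply/and3P; split => //.
  apply/finset.trivIsetP => B C /finset.setDP[BP _] /finset.setDP[CP _].
  apply: contraR => /pred0Pn[x /= /andP[xB xC]].
  by rewrite (subpart_triv BP CP xB xC).
by apply/negP => /finset.setDP[/subpart_neq0/eqP].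
Qed.

Definition dead_blocks P Q S := Subpart (dead_blocks_subproof P Q S).

Lemma in_dead_blocks P Q S B :
  (B \in dead_blocks P Q S) = [&& B \in P, B \notin Q & B \notin S].
Proof. by rewrite finset.in_setD finset.in_setU negb_or andbC. Qed.

Lemma Pi_zpow_mobius P Q S : (Q <= P)%O -> (S <= P)%O ->
  Pi_zpow (zpow_of P - zpow_of Q - zpow_of S + zpow_of (Q `&` S)%O) =
  dead_blocks P Q S.
Proof.
move=> QP SP; set f := (_ + zpow_of _).
have fE B : f B = (B \in P)%:R - (B \in Q)%:R - (B \in S)%:R
                  + (B \in (Q `&` S)%O)%:R.
  by rewrite /f !ffunE !zpow_ofE.
apply/le_anti/andP; split.
  apply/joinsP => B fB.
  have QSQ : (Q `&` S <= Q)%O by exact: leIl.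
  have [B0 [C CP BC]] : B != finset.set0 /\ exists2 C, C \in P & B \subset C.
    (* A nonzero coefficient makes [B] a block of one of the four subpartitions, all of them below
       [P]. *)
    have [T /= TP BT] : exists2 T, (T <= P)%O & B \in T.
      move: fB; rewrite fE.
      have [?|_] := boolP (B \in P); first by exists P.
      have [?|_] := boolP (B \in Q); first by exists Q.
      have [?|_] := boolP (B \in S); first by exists S.
      have [?|_] := boolP (B \in (Q `&` S)%O); last by rewrite !subr0 ?addr0 eqxx.
      by exists (Q `&` S)%O => //; exact: le_trans QSQ QP.
    by split; [exact: subpart_neq0 BT|exact: (subpart_leP _ _ TP)].
  apply/single_le => //; exists C => //; rewrite in_dead_blocks CP /=.
  apply/andP; split; apply/negP; [move=> CQ|move=> CS]; move: fB; rewrite fE.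
    have [-> ->] := common_block P Q S B C QP SP CP CQ BC.
    by rewrite subrr sub0r addNr eqxx.
  have [-> ->] := common_block P S Q B C SP QP CP CS BC.
  by rewrite meetC [_ - _ - _]addrAC subrr sub0r addNr eqxx.
apply/subpart_leP => B BN; have B0 := subpart_neq0 BN.
move: BN; rewrite in_dead_blocks => /and3P[BP BQ BS].
apply/single_le => //; apply: joins_sup.
(* The last term adds 0 or 1 to the coefficient 1, so the sum is nonzero in either case. *)
rewrite fE BP (negPf BQ) (negPf BS) !subr0.
by case: (_ \in _).
Qed.

End Subpartitions.

(** * Meets over sets of times *)

Section Bigmeet.
Context {R : realType} {X : finType}.
Implicit Types (theta : R -> subpart X) (A B : set R) (P : subpart X).

Lemma le_bigmeet theta P A :
  (P <= bigmeet theta A)%O <-> forall t, A t -> (P <= theta t)%O.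
Proof.
split=> [/meetsP h t At|h]; first by apply: h; apply/mem_set; exists t.
by apply/meetsP => _ /set_mem[t At <-]; exact: h.
Qed.

Lemma bigmeet_anti theta A B : A `<=` B ->
  (bigmeet theta B <= bigmeet theta A)%O.
Proof.
by move=> AB; apply/le_bigmeet => t /AB; exact: (le_bigmeet theta _ B).1.
Qed.

Lemma bigmeetU theta A B :
  bigmeet theta (A `|` B) = (bigmeet theta A `&` bigmeet theta B)%O.
Proof.
apply/le_anti/andP; split.
  rewrite lexI; apply/andP; split; apply: bigmeet_anti.
    exact: subsetUl.
  exact: subsetUr.
apply/le_bigmeet => t [At|Bt].
  exact: le_trans (leIl _ _) ((le_bigmeet _ _ A).1 (lexx _) _ At).
exact: le_trans (leIr _ _) ((le_bigmeet _ _ B).1 (lexx _) _ Bt).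
Qed.

(** Read through [single], the condition at all times of [A] is one inequality below the meet over
    [A]. *)
Lemma group_overP theta (G : {set X}) A : G != finset.set0 ->
  group_over theta G A <->
  is_interval A /\ exists2 C, C \in bigmeet theta A & G \subset C.
Proof.
move=> G0; rewrite /group_over; split=> -[iA gA]; split=> //.
  apply/(single_le _ _ G0)/le_bigmeet => t At.
  by apply/(single_le _ _ G0)/gA.
move=> t At; apply/(single_le _ _ G0).
by move/(single_le _ _ G0)/le_bigmeet: gA; apply.
Qed.

End Bigmeet.

(** * Intervals with integer endpoints and their elementary extensions *)

Section IntegerIntervals.
Context {R : realType}.
Implicit Types (J : zitv) (t : R).

Lemma zsetP J t : zset R J t <->
  (if (zlo J).1 then (zlo J).2%:~R <= t else (zlo J).2%:~R < t) /\
  (if (zhi J).1 then t < (zhi J).2%:~R else t <= (zhi J).2%:~R).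
Proof.
rewrite /zset /= in_itv /=.
by case: (zlo J) (zhi J) => [[] m] [[] n] /=; split=> [/andP|] //; move/andP.
Qed.

Lemma zset_neq0 J : zset R J !=set0.
Proof. exact/zitv_nonempty/zitvP. Qed.

Lemma zset_interval J : is_interval (zset R J).
Proof. exact: interval_is_interval. Qed.

Lemma sub_zext_left J : zset R J `<=` zset R (zext_left J).
Proof.
move=> t /zsetP[lo hi]; apply/zsetP; split=> //=.
move: lo; rewrite /bound_left; case: (zlo J) => -[] m /= mt; last exact: ltW.
by rewrite (lt_le_trans _ mt)// ltr_int ltrBlDr ltzD1.
Qed.

Lemma sub_zext_right J : zset R J `<=` zset R (zext_right J).
Proof.
move=> t /zsetP[lo hi]; apply/zsetP; split=> //=.
move: hi; rewrite /bound_right; case: (zhi J) => -[] m /= mt; first exact: ltW.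
by rewrite (le_lt_trans mt)// ltr_int ltzD1.
Qed.

Lemma zext_left_neq J : zset R (zext_left J) <> zset R J.
Proof.
have [t /zsetP[lo hi]] := zset_neq0 J.
suff [s sl sJ] : exists2 s, zset R (zext_left J) s & ~ zset R J s.
  by move=> E; apply: sJ; rewrite -E.
pose m : R := (zlo J).2%:~R.
(* A closed left end [m] moves to an open [m - 1], which adds [m - 1/2]; an open one gains [m]
   itself. *)
pose s := if (zlo J).1 then m - 2^-1 else m.
exists s; last first.
  move=> /zsetP[+ _]; rewrite /s -/m; case: (zlo J).1; last by rewrite ltxx.
  by move=> ?; lra.
apply/zsetP; split.
  rewrite /= /bound_left /s -/m; case: (zlo J).1 => //=.
  by rewrite intrB -/m; lra.
have st : s < t by move: lo; rewrite /s -/m; case: (zlo J).1 => //; lra.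
move: hi => /=; case: (zhi J).1 => ht; first exact: lt_trans ht.
exact: le_trans (ltW st) ht.
Qed.

Lemma zext_right_neq J : zset R (zext_right J) <> zset R J.
Proof.
have [t /zsetP[lo hi]] := zset_neq0 J.
suff [s sl sJ] : exists2 s, zset R (zext_right J) s & ~ zset R J s.
  by move=> E; apply: sJ; rewrite -E.
pose m : R := (zhi J).2%:~R.
pose s := if (zhi J).1 then m else m + 2^-1.
exists s; last first.
  move=> /zsetP[_]; rewrite /s -/m; case: (zhi J).1; first by rewrite ltxx.
  by move=> ?; lra.
apply/zsetP; split; last first.
  rewrite /= /bound_right /s -/m; case: (zhi J).1 => //=.
  by rewrite intrD -/m; lra.
have ts : t < s by move: hi; rewrite /s -/m; case: (zhi J).1 => //; lra.
move: lo => /=; case: (zlo J).1 => lt; last exact: lt_trans ts.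
exact: le_trans lt (ltW ts).
Qed.

Lemma is_intervalU (A B : set R) t : is_interval A -> is_interval B ->
  A t -> B t -> is_interval (A `|` B).
Proof.
move=> iA iB At Bt x y ABx ABy z /andP[xz zy].
have [zt|/ltW tz] := leP z t.
  case: ABx => [Ax|Bx]; [left; apply: iA Ax At _ _|right; apply: iB Bx Bt _ _];
  by rewrite xz.
case: ABy => [Ay|By]; [left; apply: iA At Ay _ _|right; apply: iB Bt By _ _];
by rewrite tz.
Qed.

End IntegerIntervals.

(** * Formigrams with integer critical points *)

Section Formigrams.
Context {R : realType} {X : finType}.
Variable theta : R -> subpart X.
Hypothesis theta_critical : integer_critical_points theta.
Implicit Types (G : {set X}) (K : set R) (n : int).

Lemma int_no_between n k (x : R) : n%:~R < x -> x < n%:~R + 1 -> x <> k%:~R.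
Proof.
move=> nx xn xk; move: nx xn; rewrite xk -[1]/(1%:~R) -intrD !ltr_int.
by rewrite ltzD1 => nk /(lt_le_trans nk); rewrite ltxx.
Qed.

Lemma theta_le_unit n s t : n%:~R < s < n%:~R + 1 ->
  n%:~R <= t <= n%:~R + 1 -> (theta s <= theta t)%O.
Proof.
have [C [Cint _ [Ccst Cle]]] := theta_critical.
(* An interval that avoids [C] is connected, hence lies in one component of the complement. *)
have cst (i : interval R) x y : x \in i -> y \in i ->
    (forall z, z \in i -> ~ C z) -> theta x = theta y.
  move=> xi yi iC; apply: Ccst.
  apply: (@connected_component_max _ _ [set` i]) => //.
  exact/connected_intervalP/interval_is_interval.
have open_nC z : z \in `]n%:~R, n%:~R + 1[ -> ~ C z.
  rewrite in_itv /= => /andP[nz zn] /Cint[k _ kz].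
  exact: int_no_between nz zn (esym kz).
have inside x y : n%:~R < x < n%:~R + 1 -> n%:~R < y < n%:~R + 1 ->
    theta x = theta y.
  by move=> xn yn; apply: (cst `]n%:~R, n%:~R + 1[); rewrite ?in_itv.
(* Below [r] the critical inequality holds; below 1 the shifted endpoint stays inside the open unit
   interval. *)
have small (r : R) : 0 < r -> exists e : R, [/\ 0 < e, e < r & e < 1].
  move=> r0; exists (Num.min r 1 / 2).
  have [? ?] : Num.min r 1 <= r /\ Num.min r 1 <= 1.
    by split; rewrite ge_min lexx ?orbT.
  have m0 : 0 < Num.min r 1 by rewrite lt_min r0 ltr01.
  by split; lra.
move=> sn /andP[]; rewrite le_eqVlt => /predU1P[<- _|nt].
  (* If the endpoint is not critical, constancy extends to the half-open interval containing it. *)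
  have [/[dup] Cn /Cle[r r0 rle]|nC] := pselect (C n%:~R); last first.
    rewrite (cst `[n%:~R, n%:~R + 1[ s n%:~R)// ?in_itv /=.
    - by case/andP: sn => /ltW-> ->.
    - by rewrite lexx ltrDl ltr01.
    - move=> z; rewrite in_itv /= le_eqVlt => /andP[/predU1P[<-//|nz zn]].
      by apply: open_nC; rewrite in_itv /= nz.
  have [e [e0 er e1]] := small r r0.
  rewrite (inside s (n%:~R + e))//; last by rewrite ltrDl e0 ltrD2l.
  by have [|] := rle e; rewrite ?er ?(ltW e0).
rewrite le_eqVlt => /predU1P[->|tn]; last by rewrite (inside s t)// nt.
have [/[dup] Cn /Cle[r r0 rle]|nC] := pselect (C (n%:~R + 1)); last first.
  rewrite (cst `]n%:~R, n%:~R + 1] s (n%:~R + 1))// ?in_itv /=.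
  - by case/andP: sn => -> /ltW ->.
  - by rewrite lexx ltrDl ltr01.
  - move=> z; rewrite in_itv /= le_eqVlt => /andP[nz /predU1P[->//|zn]].
    by apply: open_nC; rewrite in_itv /= nz.
have [e [e0 er e1]] := small r r0.
rewrite (inside s (n%:~R + 1 - e))//; last by apply/andP; split; lra.
by have [|] := rle e; rewrite ?er ?(ltW e0).
Qed.

Lemma group_over_unit G K n s : G != finset.set0 -> group_over theta G K ->
  K s -> n%:~R < s < n%:~R + 1 ->
  group_over theta G (K `|` `[n%:~R, n%:~R + 1]).
Proof.
move=> G0 [iK gK] Ks sn; split.
  apply: (@is_intervalU _ _ _ s) => //; first exact: interval_is_interval.
  by rewrite /= in_itv /=; case/andP: sn => /ltW-> /ltW.
move=> t [Kt|]; first exact: gK.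
rewrite /= in_itv /= => tn; apply/(single_le _ _ G0).
by apply: le_trans (theta_le_unit _ _ _ sn tn); apply/(single_le _ _ G0)/gK.
Qed.

Lemma group_over_sub G K K' : is_interval K' -> K' `<=` K ->
  group_over theta G K -> group_over theta G K'.
Proof. by move=> iK' KK' [_ gK]; split=> // t /KK'/gK. Qed.

(** The point [t] of [K] lies to the right of [J]. Either convexity of [K] already covers what the
    extension adds, or [t] is inside the unit interval next to [J], and the group spreads over that
    whole interval. *)
Lemma group_over_zext_right G K J s t : G != finset.set0 ->
  group_over theta G K -> zset R J `<=` K -> zset R J s -> K t ->
  ~ zset R J t -> s <= t -> group_over theta G (zset R (zext_right J)).
Proof.
move=> G0 gK JK Js Kt nJt st.
have [iK _] := gK.
have iKs u : s <= u <= t -> K u by move=> ut; apply: iK (JK _ Js) Kt _ ut.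
have inJ u : u <= s -> zset R (zext_right J) u -> zset R J u.
  move=> us /zsetP[lo _]; apply/zsetP; split=> //.
  have /zsetP[_] := Js; case: (zhi J).1 => hs; [exact: le_lt_trans hs|].
  exact: le_trans us hs.
have dt : if (zhi J).1 then (zhi J).2%:~R <= t else (zhi J).2%:~R < t.
  have /zsetP[lo _] := Js.
  have lot : if (zlo J).1 then (zlo J).2%:~R <= t else (zlo J).2%:~R < t.
    case: (zlo J).1 lo => lo; [exact: le_trans st|exact: lt_le_trans st].
  by case: ifP => hJ; [rewrite leNgt|rewrite ltNge]; apply/negP => td;
    apply: nJt; apply/zsetP; rewrite hJ.
(* An open right end only gains its endpoint, which lies between [s] and [t]. *)
have [hJ|hJ] := boolP (zhi J).1.
  apply: (group_over_sub _ K) => //; first exact: zset_interval.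
  move=> u Ju; have [us|/ltW su] := leP u s; first exact/JK/inJ.
  apply: iKs; rewrite su /=; move: Ju dt => /zsetP[_].
  by rewrite /= /bound_right hJ /=; exact: le_trans.
move: dt; rewrite (negPf hJ) => dt.
have hi u : zset R (zext_right J) u -> u < (zhi J).2%:~R + 1.
  by move=> /zsetP[_]; rewrite /= /bound_right (negPf hJ) /= intrD.
have [t1|t1] := leP ((zhi J).2%:~R + 1) t.
  apply: (group_over_sub _ K) => //; first exact: zset_interval.
  move=> u Ju; have [us|/ltW su] := leP u s; first exact/JK/inJ.
  by apply: iKs; rewrite su (le_trans (ltW (hi _ Ju))).
have tn : (zhi J).2%:~R < t < (zhi J).2%:~R + 1 by rewrite dt.
apply: group_over_sub (group_over_unit _ _ _ _ G0 gK Kt tn).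
  exact: zset_interval.
move=> u Ju; have [ud|/ltW du] := leP u (zhi J).2%:~R.
  left; apply: JK; have /zsetP[lo _] := Ju.
  by apply/zsetP; rewrite (negPf hJ).
by right; rewrite /= in_itv /= du (ltW (hi _ Ju)).
Qed.

Lemma group_over_zext_left G K J s t : G != finset.set0 ->
  group_over theta G K -> zset R J `<=` K -> zset R J s -> K t ->
  ~ zset R J t -> t <= s -> group_over theta G (zset R (zext_left J)).
Proof.
move=> G0 gK JK Js Kt nJt ts.
have [iK _] := gK.
have iKs u : t <= u <= s -> K u by move=> ut; apply: iK Kt (JK _ Js) _ ut.
have inJ u : s <= u -> zset R (zext_left J) u -> zset R J u.
  move=> su /zsetP[_ hi]; apply/zsetP; split=> //.
  have /zsetP[+ _] := Js; case: (zlo J).1 => ls; [exact: le_trans su|].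
  exact: lt_le_trans su.
have dt : if (zlo J).1 then t < (zlo J).2%:~R else t <= (zlo J).2%:~R.
  have /zsetP[_ hi] := Js.
  have hit : if (zhi J).1 then t < (zhi J).2%:~R else t <= (zhi J).2%:~R.
    case: (zhi J).1 hi => hi; [exact: le_lt_trans hi|exact: le_trans hi].
  by case: ifP => hJ; [rewrite ltNge|rewrite leNgt]; apply/negP => td;
    apply: nJt; apply/zsetP; rewrite hJ.
have [hJ|hJ] := boolP (zlo J).1; last first.
  apply: (group_over_sub _ K) => //; first exact: zset_interval.
  move=> u Ju; have [us|/ltW su] := leP s u; first exact/JK/inJ.
  apply: iKs; rewrite su andbT; move: Ju dt => /zsetP[+ _].
  by rewrite /= /bound_left (negPf hJ) /= => /[swap]; exact: le_trans.
move: dt; rewrite hJ => dt.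
(* The unit interval to fill ends at the left end of [J], so it starts at [n]. *)
set n := (zlo J).2 - 1.
have nE : (zlo J).2%:~R = n%:~R + 1 :> R by rewrite /n intrB subrK.
have lo u : zset R (zext_left J) u -> n%:~R < u.
  by move=> /zsetP[+ _]; rewrite /= /bound_left hJ.
have [t1|t1] := leP t n%:~R.
  apply: (group_over_sub _ K) => //; first exact: zset_interval.
  move=> u Ju; have [us|/ltW su] := leP s u; first exact/JK/inJ.
  by apply: iKs; rewrite su (le_trans t1 (ltW (lo _ Ju))).
have tn : n%:~R < t < n%:~R + 1 by rewrite t1 -nE.
apply: group_over_sub (group_over_unit _ _ _ _ G0 gK Kt tn).
  exact: zset_interval.
move=> u Ju; have [ud|/ltW du] := leP (zlo J).2%:~R u.
  left; apply: JK; have /zsetP[_ hi] := Ju.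
  by apply/zsetP; rewrite hJ.
by right; rewrite /= in_itv /= -nE du (ltW (lo _ Ju)).
Qed.

Lemma maximal_group_zset G J : G != finset.set0 ->
  maximal_group theta G (zset R J) <->
  G \in dead_blocks (bigmeet theta (zset R J))
          (bigmeet theta (zset R (zext_right J)))
          (bigmeet theta (zset R (zext_left J))).
Proof.
move=> G0; have iJ := @zset_interval R.
have bigP K := group_overP theta G K G0.
(* [H] is squeezed between [G] and a block of the meet over [J'], itself inside a block of the meet
   over [J]; that last block contains the block [G], so all four sets agree. *)
have sub_eq (J' : zitv) H : group_over theta H (zset R J') ->
    zset R J `<=` zset R J' -> G \in bigmeet theta (zset R J) ->
    G \subset H -> G = H /\ H \in bigmeet theta (zset R J').
  move=> gH JJ' GJ GH; have H0 : H != finset.set0.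
    by apply: contraNneq G0 => H0; rewrite -finset.subset0 -H0.
  have [_ [D DJ' HD]] := (group_overP _ _ _ H0).1 gH.
  have [E EJ DE] := subpart_leP _ _ (bigmeet_anti theta _ _ JJ') _ DJ'.
  have GD := fintype.subset_trans GH HD.
  have GE := sub_block_eq GJ EJ (fintype.subset_trans GD DE).
  have GDE : G = D by apply/eqP; rewrite finset.eqEsubset GD GE DE.
  have GHE : G = H by apply/eqP; rewrite finset.eqEsubset GH GDE HD.
  by rewrite -GHE; split=> //; rewrite GDE.
split.
  move=> [gG maxG]; have [_ [C CJ GC]] := (bigP _).1 gG.
  (* The block [C] around [G] is itself a group on the same interval, so maximality leaves no room
     between them. *)
  have GCE : G = C.
    apply: contrapT => nGC; apply: maxG; exists C, (zset R J); split.
    - apply/group_overP; first exact: subpart_neq0 CJ.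
      by split=> //; exists C.
    - by move=> [/esym].
    - by split.
  rewrite in_dead_blocks {1}GCE CJ -negb_or /=; apply/negP => GJ'.
  have [J' [GJ'' sJ' nJ']] : exists J', [/\ G \in bigmeet theta (zset R J'),
      zset R J `<=` zset R J' & zset R J' <> zset R J].
    case/orP: GJ' => GJ'.
      by exists (zext_right J); split=> //;
        [exact: sub_zext_right|exact: zext_right_neq].
    by exists (zext_left J); split=> //;
      [exact: sub_zext_left|exact: zext_left_neq].
  apply: maxG; exists G, (zset R J'); split=> //; last by case.
  by apply/bigP; split=> //; exists G.
rewrite in_dead_blocks => /and3P[GJ nr nl]; split.
  by apply/bigP; split=> //; exists G.
move=> [H [K [gH neq [GH JK]]]].
have H0 : H != finset.set0.
  by apply: contraNneq G0 => H0; rewrite -finset.subset0 -H0.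
(* Restricted to [J], the cover has the same set [G]; it can only be larger in time. *)
have [GHE _] := sub_eq J H (group_over_sub _ _ _ (iJ J) JK gH)
  (fun=> id) GJ GH.
have [t Kt nJt] : exists2 t, K t & ~ zset R J t.
  apply: contrapT => no; apply: neq; rewrite -GHE; congr (_, _).
  apply/seteqP; split=> // t Kt; apply: contrapT => nJt.
  by apply: no; exists t.
have [s Js] := @zset_neq0 R J.
have [st|/ltW ts] := leP s t.
  have gr := group_over_zext_right _ _ _ _ _ H0 gH JK Js Kt nJt st.
  have [E HJ] := sub_eq _ _ gr (@sub_zext_right R J) GJ GH.
  by rewrite E HJ in nr.
have gl := group_over_zext_left _ _ _ _ _ H0 gH JK Js Kt nJt ts.
have [E HJ] := sub_eq _ _ gl (@sub_zext_left R J) GJ GH.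
by rewrite E HJ in nl.
Qed.

Lemma maximal_group_diagramE J : maximal_group_diagram theta J =
  dead_blocks (bigmeet theta (zset R J))
    (bigmeet theta (zset R (zext_right J)))
    (bigmeet theta (zset R (zext_left J))).
Proof.
(* [meetC] is there because the union in the diagram lists the left extension first. *)
rewrite /maximal_group_diagram /dgm_meet bigmeetU meetC Pi_zpow_mobius//.
  exact/bigmeet_anti/sub_zext_right.
exact/bigmeet_anti/sub_zext_left.
Qed.

Lemma maximal_group_unit G K n s : G != finset.set0 ->
  maximal_group theta G K -> K s -> n%:~R < s < n%:~R + 1 ->
  `[n%:~R, n%:~R + 1] `<=` K.
Proof.
move=> G0 [gK maxK] Ks sn; apply: contrapT => nsub; apply: maxK.
exists G, (K `|` `[n%:~R, n%:~R + 1]); split.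
- exact: group_over_unit sn.
- by move=> [KU]; apply: nsub; rewrite -KU; exact: subsetUr.
- by split=> //; exact: subsetUl.
Qed.

(** An integer [s] is its own floor and ceiling; any other [s] brings its whole closed unit interval
    into [K]. *)
Lemma maximal_group_floor_ceil G K s : G != finset.set0 ->
  maximal_group theta G K -> K s ->
  K (Num.floor s)%:~R /\ K (Num.ceil s)%:~R.
Proof.
move=> G0 mK Ks; have /andP[fs sf] := floor_itv s.
have [fsE|fsN] := eqVneq (Num.floor s)%:~R s.
  have -> : Num.ceil s = Num.floor s by rewrite -[in LHS]fsE intrKceil.
  by rewrite fsE.
have fs' : (Num.floor s)%:~R < s by rewrite lt_neqAle fsN.
have cE : Num.ceil s = Num.floor s + 1.
  by apply: ceil_def; rewrite addrK fs' (ltW sf).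
rewrite cE; rewrite intrD in sf *.
have sub := maximal_group_unit _ _ _ _ G0 mK Ks (introT andP (conj fs' sf)).
by split; apply: sub; rewrite /= in_itv /= ?lexx ?lerDl ?ler01.
Qed.

Lemma maximal_group_integer G K : G != finset.set0 ->
  bounded_set (formigram_support theta) -> K !=set0 ->
  maximal_group theta G K -> exists J : zitv, K = zset R J.
Proof.
move=> G0 [M [_ bM]] K0 mK; have [[iK gK] _] := mK.
(* Any [x] in [G] is alive throughout [K], so [K] lies in the support. The bound holds for every
   number above [M], whence [M + 1]. *)
have KM t : K t -> `|t| <= M + 1.
  move=> Kt; apply: (bM (M + 1)); first by rewrite ltrDl.
  have /finset.set0Pn[x xG] := G0; have [B Bt GB] := gK _ Kt.
  exists x => //; apply/finset.bigcupP; exists B => //.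
  exact: fintype.subsetP GB _ xG.
have lbK : has_lbound K.
  by exists (- (M + 1)) => t /KM; rewrite ler_norml => /andP[].
have ubK : has_ubound K.
  by exists (M + 1) => t /KM; rewrite ler_norml => /andP[].
pose a := Num.floor (inf K); pose b := Num.ceil (sup K).
have /andP[ai ia] := floor_itv (inf K).
have /andP[bs sb] := ceil_itv (sup K).
have aK t : K t -> a%:~R <= t by move=> /(ge_inf lbK); exact: le_trans.
have Kb t : K t -> t <= b%:~R.
  by move=> /(ub_le_sup ubK) /le_trans; apply.
have Ka : K a%:~R.
  (* A point of [K] close enough to the infimum has floor [a], which puts [a] in [K]; the ceiling
     [b] of the supremum is reached in the same way. *)
  have [s Ks sa] := inf_lt K0 ia.
  have [+ _] := maximal_group_floor_ceil _ _ _ G0 mK Ks.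
  by rewrite (@floor_def _ s a)// aK.
have Kb' : K b%:~R.
  have [s Ks sb'] := sup_gt K0 bs.
  have [_] := maximal_group_floor_ceil _ _ _ G0 mK Ks.
  by rewrite (@ceil_def _ s b)// sb' Kb.
(* These bounds encode the closed interval from [a] to [b], possibly a single point. *)
have ab : (BSide (true, a).1 (true, a).2 < BSide (false, b).1 (false, b).2)%O.
  by rewrite /= bnd_simp -(ler_int R) aK.
exists (Zitv ab); apply/seteqP; split=> t; rewrite /zset /= in_itv /=.
  by move=> Kt; rewrite aK ?Kb.
by move=> tab; apply: iK Ka Kb' _ tab.
Qed.

End Formigrams.

Theorem theorem6p17 (R : realType) (X : finType) (theta : R -> subpart X)
    (X_nonempty : (0 < #|X|)%N)
    (theta_formigram : formigram theta)
    (theta_bounded : bounded_set (formigram_support theta))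
    (theta_critical : integer_critical_points theta)
    (G : {set X}) (G_nonempty : G != finset.set0)
    (I : set R) (I_interval : is_interval I) (I_nonempty : I !=set0) :
  maximal_group theta G I <->
  exists2 J : zitv, I = zset R J & G \in maximal_group_diagram theta J.
Proof.
split=> [mG|[J -> GJ]].
  have [J IJ] := maximal_group_integer _ theta_critical _ _ G_nonempty
    theta_bounded I_nonempty mG.
  exists J => //; rewrite maximal_group_diagramE.
  by apply/maximal_group_zset => //; rewrite -IJ.
by apply/maximal_group_zset => //; rewrite -maximal_group_diagramE.
Qed.
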